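(* The class of hemi-Nelson algebras is a variety.
   Context: A Kleene algebra is a bounded distributive lattice $\langle T,\wedge,\vee,0,1\rangle$ with a unary operation $\sim$ such that $\sim\sim x=x$, $\sim(x\wedge y)=\sim x\vee\sim y$ and $(x\wedge\sim x)\wedge(y\vee\sim y)=x\wedge\sim x$. A hemi-Nelson algebra is an algebra $\langle T,\wedge,\vee,\rightarrow,\sim,0,1\rangle$ of type $(2,2,2,1,0,0)$ such that $\langle T,\wedge,\vee,\sim,0,1\rangle$ is a Kleene algebra and for all $x,y,z\in T$: (hN1) $x\rightarrow x=1$; (hN2) $x\wedge(x\rightarrow y)\le x\wedge(\sim x\vee y)$; (hN3) $\sim(x\rightarrow y)\rightarrow(x\wedge\sim y)=1$; (hN4) $(x\wedge\sim y)\rightarrow\sim(x\rightarrow y)=1$; (hN5) $(x\wedge y\wedge(x\rightarrow y))\rightarrow(x\wedge(x\rightarrow y))=1$; (hN6) $(x\wedge(x\rightarrow y))\rightarrow(x\wedge y\wedge(x\rightarrow y))=1$; (hN7) if $x\rightarrow y=1$, $y\rightarrow x=1$, $y\rightarrow z=1$ and $z\rightarrow y=1$ then $x\rightarrow z=1$ and $z\rightarrow x=1$; (hN8) if $x\rightarrow y=1$ and $y\rightarrow x=1$ then $(x\wedge z)\rightarrow(y\wedge z)=1$; (hN9) if $x\rightarrow y=1$ and $y\rightarrow x=1$ then $(x\vee z)\rightarrow(y\vee z)=1$; (hN10) if $x\rightarrow y=1$ and $y\rightarrow x=1$ then $(x\rightarrow z)\rightarrow(y\rightarrow z)=1$ and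 $(z\rightarrow x)\rightarrow(z\rightarrow y)=1$. *)

(* Defs.v *)
From mathcomp Require Import ssreflect ssrfun ssrbool.

Set Implicit Arguments.
Unset Strict Implicit.
Unset Printing Implicit Defensive.

(* Algebras of type (2,2,2,1,0,0), with no axioms imposed. *)
Record algebra : Type := Algebra {
  carrier :> Type;
  meet : carrier -> carrier -> carrier;
  join : carrier -> carrier -> carrier;
  imp  : carrier -> carrier -> carrier;
  neg  : carrier -> carrier;
  bot  : carrier;
  top  : carrier
}.

Arguments bot {a}.
Arguments top {a}.

Declare Scope alg_scope.
Delimit Scope alg_scope with alg.
Notation "x ∧ y" := (meet x y) (at level 40, left associativity) : alg_scope.
Notation "x ∨ y" := (join x y) (at level 50, left associativity) : alg_scope.
Notation "x ⇒ y" := (imp x y) (at level 55, right associativity) : alg_scope.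
Notation "∼ x" := (neg x) (at level 35, right associativity) : alg_scope.
Notation "x ≤ y" := (meet x y = x) (at level 70, no associativity) : alg_scope.
Notation "'𝟎'" := bot : alg_scope.
Notation "'𝟏'" := top : alg_scope.
Local Open Scope alg_scope.

Record bounded_distributive_lattice (T : algebra) : Prop := {
  meetA : associative (@meet T);
  meetC : commutative (@meet T);
  joinA : associative (@join T);
  joinC : commutative (@join T);
  joinKI : forall x y : T, x ∧ (x ∨ y) = x;
  meetKU : forall x y : T, x ∨ (x ∧ y) = x;
  meetUr : right_distributive (@meet T) (@join T);
  le0x : forall x : T, 𝟎 ≤ x;
  lex1 : forall x : T, x ≤ 𝟏
}.

Record kleene_algebra (T : algebra) : Prop := {
  kleene_lattice :> bounded_distributive_lattice T;
  negK : involutive (@neg T);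
  negI : forall x y : T, ∼ (x ∧ y) = ∼ x ∨ ∼ y;
  kleene_le : forall x y : T, (x ∧ ∼ x) ∧ (y ∨ ∼ y) = x ∧ ∼ x
}.

Record hemi_Nelson_algebra (T : algebra) : Prop := {
  hemi_Nelson_kleene :> kleene_algebra T;
  hN1 : forall x : T, (x ⇒ x) = 𝟏;
  hN2 : forall x y : T, x ∧ (x ⇒ y) ≤ x ∧ (∼ x ∨ y);
  hN3 : forall x y : T, (∼ (x ⇒ y) ⇒ (x ∧ ∼ y)) = 𝟏;
  hN4 : forall x y : T, ((x ∧ ∼ y) ⇒ ∼ (x ⇒ y)) = 𝟏;
  hN5 : forall x y : T, ((x ∧ y ∧ (x ⇒ y)) ⇒ (x ∧ (x ⇒ y))) = 𝟏;
  hN6 : forall x y : T, ((x ∧ (x ⇒ y)) ⇒ (x ∧ y ∧ (x ⇒ y))) = 𝟏;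
  hN7 : forall x y z : T,
    (x ⇒ y) = 𝟏 -> (y ⇒ x) = 𝟏 -> (y ⇒ z) = 𝟏 -> (z ⇒ y) = 𝟏 ->
    (x ⇒ z) = 𝟏 /\ (z ⇒ x) = 𝟏;
  hN8 : forall x y z : T,
    (x ⇒ y) = 𝟏 -> (y ⇒ x) = 𝟏 -> ((x ∧ z) ⇒ (y ∧ z)) = 𝟏;
  hN9 : forall x y z : T,
    (x ⇒ y) = 𝟏 -> (y ⇒ x) = 𝟏 -> ((x ∨ z) ⇒ (y ∨ z)) = 𝟏;
  hN10 : forall x y z : T,
    (x ⇒ y) = 𝟏 -> (y ⇒ x) = 𝟏 ->
    ((x ⇒ z) ⇒ (y ⇒ z)) = 𝟏 /\ ((z ⇒ x) ⇒ (z ⇒ y)) = 𝟏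
}.

Inductive term : Type :=
  | Var of nat
  | Meet of term & term
  | Join of term & term
  | Imp of term & term
  | Neg of term
  | Bot
  | Top.

Fixpoint eval (T : algebra) (v : nat -> T) (t : term) : T :=
  match t with
  | Var n => v n
  | Meet s t => eval v s ∧ eval v t
  | Join s t => eval v s ∨ eval v t
  | Imp s t => eval v s ⇒ eval v t
  | Neg s => ∼ eval v s
  | Bot => 𝟎
  | Top => 𝟏
  end.

Definition satisfies (T : algebra) (s t : term) : Prop :=
  forall v : nat -> T, eval v s = eval v t.

(* A set of identities is a binary relation on terms: E s t means that the
   identity s = t belongs to the set. *)
Definition variety (K : algebra -> Prop) : Prop :=
  exists E : term -> term -> Prop,
    forall T : algebra, K T <-> (forall s t : term, E s t -> satisfies T s t).

(* Main.v *)
From mathcomp Require Import ssreflect ssrfun ssrbool.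
Require Import Defs.

Set Implicit Arguments.
Unset Strict Implicit.
Unset Printing Implicit Defensive.
Local Open Scope alg_scope.

(** Only hN7-hN10 are not identities.  Write [x ≈ y] for [x ⇒ y = 𝟏] and
    [y ⇒ x = 𝟏], and put [e := (x ⇒ y) ∧ (y ⇒ x)].  By hN5 and hN6,
    [x ∧ (x ⇒ y) ≈ x ∧ y ∧ (x ⇒ y)], whence [x ∧ e ≈ x ∧ y ∧ e ≈ y ∧ e] for all
    [x], [y].  Hence a quasi-identity [x ≈ y -> f x y = 𝟏] holds in the
    hemi-Nelson algebras only if the identity [f (x ∧ e) (y ∧ e) = 𝟏] does, and
    the identity gives the quasi-identity back, because [x ≈ y] means
    [e = 𝟏]. *)

Definition impeq (T : algebra) (x y : T) : Prop := (x ⇒ y) = 𝟏 /\ (y ⇒ x) = 𝟏.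

Definition biimp (T : algebra) (x y : T) : T := (x ⇒ y) ∧ (y ⇒ x).

(** Plays the role of [e] for hN7, whose premises chain two equivalences: it equals [𝟏] once [x ≈ y]
    and [y ≈ z]. *)
Definition biimp2 (T : algebra) (x y z : T) : T := biimp x y ∧ biimp y z.

Lemma biimp_impeq (T : algebra) (x y : T) :
  bounded_distributive_lattice T -> impeq x y -> biimp x y = 𝟏.
Proof. by move=> L [xy yx]; rewrite /biimp xy yx (lex1 L). Qed.

Section HemiNelson.
Variables (T : algebra) (hT : hemi_Nelson_algebra T).
Implicit Types x y z : T.

Lemma impeq_sym x y : impeq x y -> impeq y x.
Proof. by case. Qed.

Lemma impeq_trans y x z : impeq x y -> impeq y z -> impeq x z.
Proof. by case=> xy yx [yz zy]; apply: (hN7 hT xy yx yz zy). Qed.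

Lemma impeq_meet z x y : impeq x y -> impeq (x ∧ z) (y ∧ z).
Proof. by case=> xy yx; split; apply: (hN8 hT). Qed.

Lemma impeq_meet_imp x y : impeq (x ∧ (x ⇒ y)) (x ∧ y ∧ (x ⇒ y)).
Proof. by split; [apply: (hN6 hT)|apply: (hN5 hT)]. Qed.

Lemma impeq_biimp x y : impeq (x ∧ biimp x y) (y ∧ biimp x y).
Proof.
(* After reassociation this is [impeq_meet_imp] met with [b ⇒ a]. Since [biimp] is symmetric up to
   [meetC], swapping [a] and [b] leads to the same right-hand side. *)
have half (a b : T) : impeq (a ∧ biimp a b) (a ∧ b ∧ biimp a b).
  rewrite /biimp !(meetA hT).
  exact: (impeq_meet _ (impeq_meet_imp _ _)).
apply: (impeq_trans (half x y)); apply: impeq_sym.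
have := half y x.
by rewrite /biimp (meetC hT (y ⇒ x)) (meetC hT y x).
Qed.

Lemma impeq_biimp2 x y z : impeq (x ∧ biimp2 x y z) (z ∧ biimp2 x y z).
Proof.
apply: (@impeq_trans (y ∧ biimp2 x y z)).
  rewrite /biimp2 !(meetA hT _ (biimp x y)).
  exact: (impeq_meet _ (impeq_biimp _ _)).
rewrite /biimp2 (meetC hT (biimp x y)) !(meetA hT _ (biimp y z)).
exact: (impeq_meet _ (impeq_biimp _ _)).
Qed.

Lemma hN7_identity x y z : ((x ∧ biimp2 x y z) ⇒ (z ∧ biimp2 x y z)) = 𝟏.
Proof. by case: (impeq_biimp2 x y z). Qed.

Lemma hN8_identity x y z :
  ((x ∧ biimp x y ∧ z) ⇒ (y ∧ biimp x y ∧ z)) = 𝟏.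
Proof. by have [? ?] := impeq_biimp x y; apply: (hN8 hT). Qed.

Lemma hN9_identity x y z :
  ((x ∧ biimp x y ∨ z) ⇒ (y ∧ biimp x y ∨ z)) = 𝟏.
Proof. by have [? ?] := impeq_biimp x y; apply: (hN9 hT). Qed.

Lemma hN10l_identity x y z :
  ((x ∧ biimp x y ⇒ z) ⇒ (y ∧ biimp x y ⇒ z)) = 𝟏.
Proof. by have [xy yx] := impeq_biimp x y; case: (hN10 hT z xy yx). Qed.

Lemma hN10r_identity x y z :
  ((z ⇒ x ∧ biimp x y) ⇒ (z ⇒ y ∧ biimp x y)) = 𝟏.
Proof. by have [xy yx] := impeq_biimp x y; case: (hN10 hT z xy yx). Qed.

End HemiNelson.

(** Axiomatizing by all identities of the class makes one inclusion immediate; for the other, a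
    model may use any identity proved in hemi-Nelson algebras. *)
Definition valid (s t : term) : Prop :=
  forall T : algebra, hemi_Nelson_algebra T -> satisfies T s t.

Definition val3 (T : algebra) (x y z : T) (n : nat) : T :=
  match n with 0 => x | 1 => y | _ => z end.

(** The first matching branch wins, so identities in fewer than three variables can be handled by
    repeating an argument. *)
Ltac reify x y z t :=
  lazymatch t with
  | x => constr:(Var 0)
  | y => constr:(Var 1)
  | z => constr:(Var 2)
  | meet ?a ?b =>
      let s := reify x y z a in let t := reify x y z b in constr:(Meet s t)
  | join ?a ?b =>
      let s := reify x y z a in let t := reify x y z b in constr:(Join s t)
  | imp ?a ?b =>
      let s := reify x y z a in let t := reify x y z b in constr:(Imp s t)
  | neg ?a => let s := reify x y z a in constr:(Neg s)
  | bot => constr:(Bot)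
  | top => constr:(Top)
  end.

(* Proves an identity in [x], [y], [z] from [model], the hypothesis that all
   valid identities hold, and from [ax], which proves it in every hemi-Nelson
   algebra. *)
Ltac transfer model x y z ax :=
  rewrite /biimp2 /biimp;
  lazymatch goal with
  | |- ?a = ?b =>
      let s := reify x y z a in
      let t := reify x y z b in
      refine (model s t _ (val3 x y z));
      let A := fresh "A" in let hA := fresh "hA" in
      move=> A hA ?; apply: (ax A hA)
  end.

Section ModelsOfValidIdentities.
Variables (T : algebra) (model : forall s t, valid s t -> satisfies T s t).

Lemma model_lattice : bounded_distributive_lattice T.
Proof.
split.
- by move=> x y z; transfer model x y z meetA.
- by move=> x y; transfer model x y x meetC.
- by move=> x y z; transfer model x y z joinA.
- by move=> x y; transfer model x y x joinC.
- by move=> x y; transfer model x y x joinKI.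
- by move=> x y; transfer model x y x meetKU.
- by move=> x y z; transfer model x y z meetUr.
- by move=> x; transfer model x x x le0x.
- by move=> x; transfer model x x x lex1.
Qed.

Lemma model_kleene : kleene_algebra T.
Proof.
split; first exact: model_lattice.
- by move=> x; transfer model x x x negK.
- by move=> x y; transfer model x y x negI.
- by move=> x y; transfer model x y x kleene_le.
Qed.

Lemma model_hemi_Nelson : hemi_Nelson_algebra T.
Proof.
have L := model_lattice.
(* One half of hN7 suffices: the other follows by exchanging [x] and [z]. *)
have N7 (x y z : T) : impeq x y -> impeq y z -> (x ⇒ z) = 𝟏.
  move=> xy yz.
  have : ((x ∧ biimp2 x y z) ⇒ (z ∧ biimp2 x y z)) = 𝟏.
    by transfer model x y z hN7_identity.
  (* The premises turn [biimp2 x y z] into [𝟏], which the lattice laws absorb. *)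
  by rewrite /biimp2 !biimp_impeq // !(lex1 L).
split; first exact: model_kleene.
- by move=> x; transfer model x x x hN1.
- by move=> x y; transfer model x y x hN2.
- by move=> x y; transfer model x y x hN3.
- by move=> x y; transfer model x y x hN4.
- by move=> x y; transfer model x y x hN5.
- by move=> x y; transfer model x y x hN6.
- by move=> x y z xy yx yz zy; split; apply: (N7 _ y).
- move=> x y z xy yx.
  have : ((x ∧ biimp x y ∧ z) ⇒ (y ∧ biimp x y ∧ z)) = 𝟏.
    by transfer model x y z hN8_identity.
  by rewrite biimp_impeq // !(lex1 L).
- move=> x y z xy yx.
  have : ((x ∧ biimp x y ∨ z) ⇒ (y ∧ biimp x y ∨ z)) = 𝟏.
    by transfer model x y z hN9_identity.
  by rewrite biimp_impeq // !(lex1 L).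
(* One identity for each argument of [⇒]. *)
- move=> x y z xy yx; split.
  + have : ((x ∧ biimp x y ⇒ z) ⇒ (y ∧ biimp x y ⇒ z)) = 𝟏.
      by transfer model x y z hN10l_identity.
    by rewrite biimp_impeq // !(lex1 L).
  + have : ((z ⇒ x ∧ biimp x y) ⇒ (z ⇒ y ∧ biimp x y)) = 𝟏.
      by transfer model x y z hN10r_identity.
    by rewrite biimp_impeq // !(lex1 L).
Qed.

End ModelsOfValidIdentities.

Theorem theorem15 : variety hemi_Nelson_algebra.
Proof.
exists valid => T; split; last exact: model_hemi_Nelson.
by move=> hT s t; apply.
Qed.
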